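(* For the weighted paging problem, the greedy algorithm that on each fault evicts a page of smallest eviction cost from the cache is bijectively optimal: for every $n$ and every online algorithm $B$ there is a bijection $\pi:\mathcal{I}_n\to\mathcal{I}_n$ with $\textsc{greedy}(\sigma)\le B(\pi(\sigma))$ for all $\sigma\in\mathcal{I}_n$.
   Context: Weighted paging: there is a finite set of pages, each page $p$ having an eviction cost $c_p>0$, and a cache holding $k$ pages (initially a given set of $k$ pages, the same for all algorithms). Requests are pages; if the requested page is not in the cache (a fault), the algorithm must bring it into the cache, evicting some page $q$ currently in the cache at cost $c_q$. The cost $A(\sigma)$ of an algorithm on $\sigma$ is the total eviction cost. $\mathcal{I}_n$ is the set of all request sequences of length $n$. (Equivalently: $k$-server on a star whose leaves are the pages, the edge to leaf $p$ having weight $c_p/2$, with requests only at leaves.) *)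

(* Defs.v *)
From mathcomp Require Import all_boot all_order all_algebra.

Set Implicit Arguments.
Unset Strict Implicit.
Unset Printing Implicit Defensive.

Import Order.TTheory GRing.Theory Num.Theory.

Local Open Scope ring_scope.

(* A deterministic online decision rule: [B h p] is the page evicted when the
   request [p], arriving after the requests [h] (oldest first), is a fault.
   The value is irrelevant when [p] is in the cache.  The cache contents need
   not be an argument, since they are determined by [h]. *)
Definition eviction_rule (T : finType) := seq T -> T -> T.

Definition next_cache (T : finType) (B : eviction_rule T)
    (h : seq T) (C : {set T}) (p : T) : {set T} :=
  if p \in C then C else p |: (C :\ B h p).

Definition step_cost (R : realFieldType) (T : finType) (c : T -> R)
    (B : eviction_rule T) (h : seq T) (C : {set T}) (p : T) : R :=
  if p \in C then 0 else c (B h p).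

(* [cache_from B h C s] and [cost_from c B h C s]: the final cache and the
   total cost when [s] is served from cache [C], the requests [h] having
   already been served. *)
Fixpoint cache_from (T : finType) (B : eviction_rule T)
    (h : seq T) (C : {set T}) (s : seq T) : {set T} :=
  if s is p :: s' then cache_from B (rcons h p) (next_cache B h C p) s' else C.

Fixpoint cost_from (R : realFieldType) (T : finType) (c : T -> R)
    (B : eviction_rule T) (h : seq T) (C : {set T}) (s : seq T) : R :=
  if s is p :: s' then
    step_cost c B h C p + cost_from c B (rcons h p) (next_cache B h C p) s'
  else 0.

Definition cache (T : finType) (B : eviction_rule T) (C0 : {set T})
  (s : seq T) : {set T} := cache_from B [::] C0 s.

Definition cost (R : realFieldType) (T : finType) (c : T -> R)
  (B : eviction_rule T) (C0 : {set T}) (s : seq T) : R :=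
  cost_from c B [::] C0 s.

Definition online_algorithm (T : finType) (C0 : {set T})
    (B : eviction_rule T) : Prop :=
  forall (h : seq T) (p : T),
    p \notin cache B C0 h -> B h p \in cache B C0 h.

(* Ties among the cheapest cached pages may be broken arbitrarily, even as a
   function of the history. *)
Definition greedy (R : realFieldType) (T : finType) (c : T -> R)
    (C0 : {set T}) (G : eviction_rule T) : Prop :=
  online_algorithm C0 G /\
  forall (h : seq T) (p : T), p \notin cache G C0 h ->
    forall q : T, q \in cache G C0 h -> c (G h p) <= c q.

Definition bijectively_optimal (R : realFieldType) (T : finType) (c : T -> R)
    (C0 : {set T}) (A : eviction_rule T) : Prop :=
  forall (n : nat) (B : eviction_rule T), online_algorithm C0 B ->
    exists pi : n.-tuple T -> n.-tuple T,
      bijective pi /\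
      forall sigma : n.-tuple T, cost c A C0 sigma <= cost c B C0 (pi sigma).

(* Main.v *)
Require Import Defs.
From mathcomp Require Import all_boot all_order all_algebra.
From mathcomp Require Import perm.

Import Order.TTheory GRing.Theory Num.Theory.

Local Open Scope ring_scope.

(** Write [V C] for the cost of a memoryless greedy algorithm from cache [C],
    and compare costs up to a bijection of the request sequences.  If
    [c g <= c q], the following two facts hold, by simultaneous induction on
    the number of requests:
    - [c g + V (X + q) <= c q + V (X + g)]: evicting the cheaper page is better;
    - [V (X + g) <= V (X + q)]: holding the cheaper page is better.
    The coupling exchanges the requests to [g] and [q] until the two caches
    meet.  The first fact at length [n] says that on the first of [n + 1]
    requests greedy beats every other eviction, so in the inductive step the
    cache on the smaller side may imitate the eviction made on the other side.
    The first fact also drives an exchange argument, step by step, against an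
    arbitrary online algorithm, and shows that tie-breaking is irrelevant. *)

(** * Comparing costs up to a relabelling of request sequences *)

Section Dominance.

Context {R : realFieldType} {T : finType}.

(** Injectivity stands in for bijectivity because [n.-tuple T] is finite. Costs take plain sequences
    so that [p :: s] needs no cast. *)
Definition dominated (n : nat) (f g : seq T -> R) : Prop :=
  exists pi : n.-tuple T -> n.-tuple T,
    injective pi /\ forall s : n.-tuple T, f s <= g (pi s).

Lemma dominated_le n f g : (forall s, f s <= g s) -> dominated n f g.
Proof. by move=> le_fg; exists id; split. Qed.

Lemma dominated_trans n g f h :
  dominated n f g -> dominated n g h -> dominated n f h.
Proof.
move=> [pi [pi_inj le_fg]] [rho [rho_inj le_gh]].
exists (rho \o pi); split; first exact: inj_comp.
by move=> s; apply: le_trans (le_fg s) (le_gh _).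
Qed.

Lemma eq_dominated n (f f' g g' : seq T -> R) : f' =1 f -> g' =1 g ->
  dominated n f g -> dominated n f' g'.
Proof.
move=> eq_f eq_g [pi [pi_inj le_fg]]; exists pi; split=> // s.
by rewrite eq_f eq_g.
Qed.

Lemma dominatedD n a b f g : a <= b ->
  dominated n f g -> dominated n (fun s => a + f s) (fun s => b + g s).
Proof.
by move=> le_ab [pi [pi_inj le_fg]]; exists pi; split=> // s; apply: lerD.
Qed.

(** The coupling of the tails may depend on the first request: equal images have equal heads, as
    [tau] is injective, hence were built with the same tail map. *)
Lemma dominated_cons n (f g : seq T -> R) (tau : T -> T) : injective tau ->
  (forall p, dominated n (fun s => f (p :: s)) (fun s => g (tau p :: s))) ->
  dominated n.+1 f g.
Proof.
move=> tau_inj /fin_all_exists[pi pi_ok].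
exists (fun s => [tuple of tau (thead s) :: pi (thead s) [tuple of behead s]]).
split=> [s t /(congr1 val)/= [/tau_inj eq_hd] /val_inj | s].
  rewrite eq_hd => /(proj1 (pi_ok _))/(congr1 val)/= eq_tl.
  by apply: val_inj; rewrite (tuple_eta s) (tuple_eta t) /= eq_hd eq_tl.
rewrite [X in f X](congr1 val (tuple_eta s)).
exact: (proj2 (pi_ok (thead s)) [tuple of behead s]).
Qed.

End Dominance.

(** * Memoryless greedy and its two coupled inequalities *)

Section GreedyCost.

Context {R : realFieldType} {T : finType}.
Variable c : T -> R.

(* The default [p] is returned only when [C] is empty. *)
Definition cheapest (C : {set T}) (p : T) : T :=
  odflt p [pick m in C | [forall q in C, c m <= c q]].

Lemma cheapestP {C : {set T}} (p : T) {q} : q \in C ->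
  cheapest C p \in C /\ forall r, r \in C -> c (cheapest C p) <= c r.
Proof.
move=> Cq; rewrite /cheapest; case: pickP => [m /andP[Cm /forall_inP min_m] //|].
case: (@Order.TotalTheory.arg_minP _ _ _ q [in C] c Cq) => m Cm min_m /(_ m) /=.
by rewrite [m \in C]Cm /= => /forall_inP[].
Qed.

Definition evict (C : {set T}) (p e : T) : {set T} := p |: (C :\ e).

Fixpoint greedy_cost (C : {set T}) (s : seq T) : R :=
  if s is p :: s' then
    if p \in C then greedy_cost C s'
    else c (cheapest C p) + greedy_cost (evict C p (cheapest C p)) s'
  else 0.

Lemma greedy_cost_hit (C : {set T}) p s :
  p \in C -> greedy_cost C (p :: s) = greedy_cost C s.
Proof. by move=> /= ->. Qed.

Definition evict_cheaper n := forall (X : {set T}) g q,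
  g \notin X -> q \notin X -> c g <= c q ->
  dominated n (fun s => c g + greedy_cost (q |: X) s)
              (fun s => c q + greedy_cost (g |: X) s).

Definition hold_cheaper n := forall (X : {set T}) g q,
  g \notin X -> q \notin X -> c g <= c q ->
  dominated n (greedy_cost (g |: X)) (greedy_cost (q |: X)).

(** The two resulting caches share [p |: (C :\ d :\ e)]; the first adds [e], the second [d]. *)
Lemma evict_cheaper_fault {n} {C : {set T}} {p d e} :
  evict_cheaper n -> p \notin C -> d \in C -> e \in C -> c d <= c e ->
  dominated n (fun s => c d + greedy_cost (evict C p d) s)
              (fun s => c e + greedy_cost (evict C p e) s).
Proof.
move=> cheaper_n Cp Cd Ce le_de.
have [->|ne_de] := eqVneq d e; first exact: dominated_le.
have ne_p r : r \in C -> r != p by move=> Cr; apply: contraNneq Cp => <-.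
have -> : evict C p d = e |: (p |: (C :\ d :\ e)).
  by apply/setP=> z; rewrite !inE; have [->|] := eqVneq z e;
     rewrite ?Ce ?(eq_sym e d) ?ne_de ?orbT.
have -> : evict C p e = d |: (p |: (C :\ d :\ e)).
  by apply/setP=> z; rewrite !inE; have [->|] := eqVneq z d;
     rewrite ?Cd ?ne_de ?orbT.
by apply: cheaper_n => //; rewrite !inE negb_or ne_p ?eqxx ?andbF.
Qed.

(** This is the imitation tool: the smaller side of a comparison may evict any chosen [e] instead of
    its cheapest page. *)
Lemma greedy_cost_fault {n} {C : {set T}} {p e} :
  evict_cheaper n -> p \notin C -> e \in C ->
  dominated n (fun s => greedy_cost C (p :: s))
              (fun s => c e + greedy_cost (evict C p e) s).
Proof.
move=> cheaper_n Cp Ce; have [Cm min_m] := cheapestP p Ce.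
apply: dominated_trans (evict_cheaper_fault cheaper_n Cp Cm Ce (min_m _ Ce)).
by apply: dominated_le => s /=; rewrite (negPf Cp).
Qed.

Lemma evict_added (X : {set T}) p q : q \notin X -> evict (q |: X) p q = p |: X.
Proof. by move=> Xq; rewrite /evict setU1K. Qed.

Lemma evict_old (X : {set T}) p q e :
  e != q -> evict (q |: X) p e = q |: evict X p e.
Proof.
move=> ne_eq; apply/setP=> z; rewrite !inE.
have [->|_] := eqVneq z q; first by rewrite (eq_sym q e) ne_eq orbT.
by [].
Qed.

Lemma notin_evict (X : {set T}) p q e :
  q \notin X -> q != p -> q \notin evict X p e.
Proof. by move=> Xq ne_qp; rewrite !inE negb_or ne_qp negb_and Xq orbT. Qed.

(* [p] and [p'] are coupled requests that hit neither cache. *)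
Variant fault_coupling (g q : T) : T -> T -> Prop :=
  | FaultSwap : fault_coupling g q g q
  | FaultSame p of p != g & p != q : fault_coupling g q p p.

(* Both caches evict the same page [e] of [X], and either become equal or
   still differ in [g] and [q] only. *)
Lemma evict_old_coupled (X : {set T}) g q p p' e :
    fault_coupling g q p p' -> e != g -> e != q ->
    g \notin X -> q \notin X ->
  evict (q |: X) p e = evict (g |: X) p' e \/
  exists Y : {set T}, [/\ g \notin Y, q \notin Y,
    evict (q |: X) p e = q |: Y & evict (g |: X) p' e = g |: Y].
Proof.
move=> pp' ne_eg ne_eq Xg Xq; rewrite !evict_old //; case: pp' => [|r rg rq].
  by left; rewrite /evict setUCA.
by right; exists (evict X r e); rewrite !notin_evict // eq_sym.
Qed.

(** Transposing [g] and [q] maps hits of [q |: X] to hits of [g |: X]. A fault of [q |: X] is either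
    [g], sent to [q], or a fixed page outside both caches. *)
Lemma dominated_swap n (f1 f2 : seq T -> R) (X : {set T}) g q :
    g \notin X -> q \notin X -> g != q ->
    (forall p, p \in q |: X ->
       dominated n (fun s => f1 (p :: s)) (fun s => f2 (tperm g q p :: s))) ->
    (forall p p', p \notin q |: X -> p' \notin g |: X ->
       fault_coupling g q p p' ->
       dominated n (fun s => f1 (p :: s)) (fun s => f2 (p' :: s))) ->
  dominated n.+1 f1 f2.
Proof.
move=> Xg Xq ne_gq hit fault; apply: (dominated_cons _ _ _ (tperm g q)).
  exact: perm_inj.
move=> p; have [/hit //|Xp] := boolP (p \in q |: X).
move: (Xp); rewrite !inE negb_or => /andP[ne_pq Xp'].
case: tpermP ne_pq Xp Xp' => [->|->|/eqP pg /eqP pq] ne_pq Xp Xp'.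
- by apply: fault Xp _ (FaultSwap _ _); rewrite !inE negb_or eq_sym ne_gq.
- by rewrite eqxx in ne_pq.
by apply: fault Xp _ (FaultSame _ _ _ pg pq); rewrite !inE negb_or pg.
Qed.

Lemma tperm_hit (X : {set T}) g q p : g \notin X -> q \notin X ->
  p \in q |: X -> tperm g q p \in g |: X.
Proof.
move=> Xg Xq; rewrite !inE => /predU1P[->|Xp]; first by rewrite tpermR eqxx.
by rewrite tpermD ?Xp ?orbT //; [apply: contraNneq Xg | apply: contraNneq Xq] => ->.
Qed.

Lemma greedy_fault_witness {C : {set T}} {p r} : r \in C -> p \notin C ->
  exists2 e, e \in C &
    forall s, c e + greedy_cost (evict C p e) s = greedy_cost C (p :: s).
Proof.
move=> Cr Cp; exists (cheapest C p); first by have [] := cheapestP p Cr.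
by move=> s /=; rewrite (negPf Cp).
Qed.

(** The case split is on the page [e] that greedy evicts from [g |: X]. If [e] is [g], the other
    side evicts [q] and both sides have paid [c g + c q]; otherwise it evicts [e] as well. *)
Lemma evict_cheaperS n :
  evict_cheaper n -> hold_cheaper n -> evict_cheaper n.+1.
Proof.
move=> evict_n hold_n X g q Xg Xq le_gq.
have [->|ne_gq] := eqVneq g q; first exact: dominated_le.
apply: (dominated_swap _ _ _ X g q) => // [p Xp | p p' Xp Xp' pp'].
  by apply: eq_dominated (evict_n X g q Xg Xq le_gq) => s;
     rewrite greedy_cost_hit ?tperm_hit.
have [e Xe cost_e] := greedy_fault_witness (setU11 g X) Xp'.
have left_le d : d \in q |: X -> dominated n
    (fun s => c d + (c g + greedy_cost (evict (q |: X) p d) s))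
    (fun s => c q + greedy_cost (g |: X) (p' :: s)) ->
  dominated n (fun s => c g + greedy_cost (q |: X) (p :: s))
              (fun s => c q + greedy_cost (g |: X) (p' :: s)).
  move=> Xd; apply: dominated_trans; apply: dominated_trans (dominatedD _ _ _ _ _ (lexx (c g))
    (greedy_cost_fault evict_n Xp Xd)) _.
  by apply: dominated_le => s; rewrite addrCA.
have right_le f : dominated n f
    (fun s => c e + (c q + greedy_cost (evict (g |: X) p' e) s)) ->
  dominated n f (fun s => c q + greedy_cost (g |: X) (p' :: s)).
  move/dominated_trans; apply; apply: dominated_le => s.
  by rewrite -cost_e addrCA.
have [eg|ne_eg] := eqVneq e g.
  apply: left_le (setU11 q X) _; apply: right_le; rewrite eg !evict_added //.
  have swap_c f : dominated n (greedy_cost (p |: X)) f ->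
    dominated n (fun s => c q + (c g + greedy_cost (p |: X) s))
                (fun s => c g + (c q + f s)).
    move=> le_f; apply: dominated_trans (dominatedD _ _ _ _ _ (lexx (c q))
      (dominatedD _ _ _ _ _ (lexx (c g)) le_f)) _.
    by apply: dominated_le => s; rewrite addrCA.
  (* After swapped requests the left cache is [g |: X] and the right one [q |: X], so [hold_n]
     applies; otherwise the caches coincide. *)
  apply: swap_c; case: pp' {Xp Xp' cost_e} => [|r _ _].
    exact: hold_n.
  exact: dominated_le.
have {}Xe : e \in X by move: Xe; rewrite !inE (negPf ne_eg).
have ne_eq : e != q by apply: contraNneq Xq => <-.
apply: left_le (setU1r q Xe) _; apply: right_le; apply: dominatedD => //.
have [->|[Y [Yg Yq -> ->]]] := evict_old_coupled X g q p p' e pp' ne_eg ne_eq Xg Xq.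
  by apply: dominated_le => s; rewrite lerD2r.
exact: evict_n.
Qed.

Lemma hold_cheaperS n :
  evict_cheaper n -> hold_cheaper n -> hold_cheaper n.+1.
Proof.
move=> evict_n hold_n X g q Xg Xq le_gq.
have [->|ne_gq] := eqVneq g q; first exact: dominated_le.
have ne_qg : q != g by rewrite eq_sym.
(* Here the left cache holds [g], so the two pages exchange roles in the coupling. *)
apply: (dominated_swap _ _ _ X q g) => // [p Xp | p p' Xp Xp' pp'].
  by apply: eq_dominated (hold_n X g q Xg Xq le_gq) => s;
     rewrite greedy_cost_hit ?tperm_hit.
have [e Xe cost_e] := greedy_fault_witness (setU11 q X) Xp'.
have right_le f : dominated n f
    (fun s => c e + greedy_cost (evict (q |: X) p' e) s) ->
  dominated n f (fun s => greedy_cost (q |: X) (p' :: s)).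
  by move/dominated_trans; apply; apply: dominated_le => s; rewrite -cost_e.
apply: right_le; have [eq|ne_eq] := eqVneq e q.
  apply: dominated_trans (greedy_cost_fault evict_n Xp (setU11 g X)) _.
  (* The left side pays [c g] and the right side [c q]; swapped requests leave [q |: X] against
     [g |: X], which is exactly [evict_n]. *)
  rewrite eq !evict_added //; case: pp' {Xp Xp' cost_e} => [|r _ _].
    exact: evict_n.
  by apply: dominated_le => s; rewrite lerD2r.
have {}Xe : e \in X by move: Xe; rewrite !inE (negPf ne_eq).
have ne_eg : e != g by apply: contraNneq Xg => <-.
apply: dominated_trans (greedy_cost_fault evict_n Xp (setU1r g Xe)) _.
apply: dominatedD => //.
have [->|[Y [Yq Yg -> ->]]] := evict_old_coupled X q g p p' e pp' ne_eq ne_eg Xq Xg.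
  exact: dominated_le.
exact: hold_n.
Qed.

Lemma evict_hold_cheaper n : evict_cheaper n /\ hold_cheaper n.
Proof.
elim: n => [|n [evict_n hold_n]]; last first.
  by split; [apply: evict_cheaperS | apply: hold_cheaperS].
split=> X g q _ _ le_gq; exists id; split=> // s; rewrite tuple0 //=.
by rewrite !addr0.
Qed.

End GreedyCost.

(** * Exchange argument for history-dependent algorithms *)

Lemma cache_rcons (T : finType) (B : eviction_rule T) C0 h p :
  cache B C0 (rcons h p) = next_cache B h (cache B C0 h) p.
Proof.
suff gen h' C : cache_from B h' C (rcons h p) =
    next_cache B (h' ++ h) (cache_from B h' C h) p by exact: gen.
by elim: h h' C => [|q h IH] h' C; rewrite /= ?cats0 // IH cat_rcons.
Qed.

(** By induction, [B] may be replaced by greedy after its first request; what remains is one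
    arbitrary eviction, covered by [greedy_cost_fault]. *)
Lemma greedy_cost_optimal (R : realFieldType) (T : finType) (c : T -> R)
    (C0 : {set T}) (B : eviction_rule T) n h : online_algorithm C0 B ->
  dominated n (greedy_cost c (cache B C0 h))
              (cost_from c B h (cache B C0 h)).
Proof.
move=> B_online; elim: n h => [|n IHn] h.
  by exists id; split=> // s; rewrite tuple0.
apply: (dominated_cons _ _ _ id) => // p.
rewrite /= /step_cost -cache_rcons.
have [Cp|Cp] := boolP (p \in cache B C0 h).
  apply: dominated_trans (dominatedD _ _ _ _ _ (lexx 0) (IHn (rcons h p))).
  by apply: dominated_le => s; rewrite add0r cache_rcons /next_cache Cp.
have [evict_n _] := evict_hold_cheaper c n.
apply: dominated_trans (dominatedD _ _ _ _ _ (lexx _) (IHn (rcons h p))).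
apply: dominated_trans _ (_ : dominated n
    (fun s => c (B h p) + greedy_cost c (evict (cache B C0 h) p (B h p)) s) _).
  have := greedy_cost_fault c evict_n Cp (B_online h p Cp).
  by rewrite /= (negPf Cp).
by apply: dominated_le => s; rewrite cache_rcons /next_cache (negPf Cp).
Qed.

(** Ties may lead [G] to a page other than [cheapest], but one that costs no more, so
    [evict_cheaper_fault] compares the two evictions. *)
Lemma greedy_dominated (R : realFieldType) (T : finType) (c : T -> R)
    (C0 : {set T}) (G : eviction_rule T) n h : greedy c C0 G ->
  dominated n (cost_from c G h (cache G C0 h))
              (greedy_cost c (cache G C0 h)).
Proof.
move=> [G_online G_min]; elim: n h => [|n IHn] h.
  by exists id; split=> // s; rewrite tuple0.
apply: (dominated_cons _ _ _ id) => // p.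
rewrite /= /step_cost -cache_rcons.
have [Cp|Cp] := boolP (p \in cache G C0 h).
  apply: dominated_trans (dominatedD _ _ _ _ _ (lexx 0) (IHn (rcons h p))) _.
  by apply: dominated_le => s; rewrite add0r cache_rcons /next_cache Cp.
have [evict_n _] := evict_hold_cheaper c n.
have Ce := G_online h p Cp; have [Cm _] := cheapestP c p Ce.
apply: dominated_trans (dominatedD _ _ _ _ _ (lexx _) (IHn (rcons h p))) _.
apply: dominated_trans (evict_cheaper_fault c evict_n Cp Ce Cm (G_min h p Cp _ Cm)).
by apply: dominated_le => s; rewrite cache_rcons /next_cache (negPf Cp).
Qed.

Theorem theorem3 (R : realFieldType) (T : finType) (c : T -> R)
    (c_gt0 : forall p : T, 0 < c p)
    (k : nat) (C0 : {set T}) (card_C0 : #|C0| = k)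
    (G : eviction_rule T) (G_greedy : greedy c C0 G) :
  bijectively_optimal c C0 G.
Proof.
move=> n B B_online.
have [pi [pi_inj le_cost]] := dominated_trans _ _ _ _
  (greedy_dominated _ _ _ _ _ n [::] G_greedy)
  (greedy_cost_optimal _ _ c _ _ n [::] B_online).
by exists pi; split; first exact: injF_bij.
Qed.
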